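(* Let $X$ be an irreducible discrete-time time-homogeneous Markov chain on a countable set $V$ with transition matrix $P=(p_{xy})_{x,y\in V}$, and let $E=\{(x,y)\in V\times V:p_{xy}>0\}$. Suppose that there exists a set $\hat E\subset E$ such that: (a) for any $y\in V$ there exists $z\in V$ with $(y,z)\in\hat E$; (b) the function $R:V\to(0,\infty)$, $R(y)=\sum_{z:(y,z)\in\hat E}p_{yz}$, vanishes at infinity; (c) for any $x\in V$ there exist constants $a_0,\lambda>0$ such that for any $0<a<a_0$ one can find a set $W=W(x,a)\subset E$ satisfying: (i) $E\setminus W$ is finite; (ii) if $(y,z)\in W$ then $R(y)<a$; (iii) for any path $x_0,x_1,\dots,x_k$ with $x_0=x$ and $(x_{i},x_{i+1})\in E$ for $0\le i\le k-1$, $$\sharp\{1\le i\le k:(x_{i-1},x_i)\in\hat E\cap W\}\ \ge\ \lambda\,\sharp\{1\le i\le k:(x_{i-1},x_i)\in W\}.$$ Then the chain compactness condition (defined in the context) holds.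
   Context: ''Vanishes at infinity'' means that for every $\epsilon>0$ there is a finite set $K\subset V$ with $|R|\le\epsilon$ off $K$. For $f:V\to(0,\infty)$, $Pf(x)=\sum_yp_{xy}f(y)$. Chain compactness condition: there exist functions $u_n:V\to(0,\infty)$, $n\ge0$, such that (i) $Pu_n(x)<\infty$ for all $x\in V$, $n\ge0$; (ii) there is a constant $c>0$ with $u_n(x)\ge c$ for all $x,n$; (iii) for each $x\in V$ there is a constant $C_x$ with $u_n(x)\le C_x$ for all $n$; (iv) $u_n/Pu_n$ converges pointwise to some $\hat u:V\to(0,\infty)$; (v) for each $\ell\in\mathbb{R}$ the set $\{x\in V:\log\hat u(x)\le\ell\}$ is finite. *)

(* Defs.v *)
From HB Require Import structures.
From mathcomp Require Import all_boot all_order all_algebra.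
From mathcomp Require Import all_classical all_reals all_analysis.
Set Implicit Arguments.
Unset Strict Implicit.
Unset Printing Implicit Defensive.
Import Order.TTheory GRing.Theory Num.Theory.
Import numFieldNormedType.Exports.
Local Open Scope classical_set_scope.
Local Open Scope ring_scope.

Definition transition_matrix (R : realType) (V : countType)
    (p : V -> V -> R) : Prop :=
  (forall x y, 0 <= p x y) /\
  (forall x, (\esum_(y in [set: V]) (p x y)%:E = 1)%E).

Fixpoint nstep (R : realType) (V : countType) (p : V -> V -> R)
    (n : nat) (x y : V) : \bar R :=
  if n is m.+1 then (\esum_(z in [set: V]) ((p x z)%:E * nstep p m z y))%E
  else ((x == y)%:R)%:E.

Definition irreducible_chain (R : realType) (V : countType)
    (p : V -> V -> R) : Prop :=
  forall x y : V, exists n : nat, (0 < nstep p n x y)%E.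

Definition edges (R : realType) (V : countType) (p : V -> V -> R) :
    set (V * V) :=
  [set e | 0 < p e.1 e.2].

Definition vanishes_at_infinity (R : realType) (V : countType)
    (f : V -> R) : Prop :=
  forall eps : R, 0 < eps ->
    exists K : set V, finite_set K /\ forall x, ~ K x -> `|f x| <= eps.

(* For a transition matrix the sum is at most 1, so [fine] loses nothing. *)
Definition mass_along (R : realType) (V : countType) (p : V -> V -> R)
    (A : set (V * V)) (y : V) : R :=
  fine (\esum_(z in [set z | A (y, z)]) (p y z)%:E)%E.

Definition is_path (V : countType) (A : set (V * V)) (x : V) (k : nat)
    (xs : nat -> V) : Prop :=
  xs 0%N = x /\ forall i, (i < k)%N -> A (xs i, xs i.+1).

(* Only xs 0, ..., xs k matter; the i-th step is counted with i from 0. *)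
Definition nb_steps (V : countType) (A : set (V * V)) (k : nat)
    (xs : nat -> V) : nat :=
  #|[pred i : 'I_k | (xs i, xs i.+1) \in A]|.

(* The value may be +oo. *)
Definition chain_op (R : realType) (V : countType) (p : V -> V -> R)
    (f : V -> R) (x : V) : \bar R :=
  (\esum_(y in [set: V]) (p x y * f y)%:E)%E.

(* [fine] in the quotient is harmless since P (u n) is required to be finite;
   it is positive because u n is and the rows of p sum to 1. *)
Definition chain_compactness (R : realType) (V : countType)
    (p : V -> V -> R) : Prop :=
  exists u : nat -> V -> R,
    (forall n x, 0 < u n x) /\
    (forall x n, (chain_op p (u n) x < +oo)%E) /\
    (exists c : R, 0 < c /\ forall x n, c <= u n x) /\
    (forall x, exists C : R, forall n, u n x <= C) /\
    exists uhat : V -> R,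
      (forall x, 0 < uhat x) /\
      (forall x,
        (fun n => u n x / fine (chain_op p (u n) x)) @ \oo --> uhat x) /\
      (forall l : R, finite_set [set x | ln (uhat x) <= l]).

(* Main.v *)
Require Import Defs.
From HB Require Import structures.
From mathcomp Require Import all_boot all_order all_algebra.
From mathcomp Require Import all_classical all_reals all_analysis.
From mathcomp Require Import lra.
Set Implicit Arguments.
Unset Strict Implicit.
Unset Printing Implicit Defensive.
Import Order.TTheory GRing.Theory Num.Theory.
Import numFieldNormedType.Exports.
Local Open Scope classical_set_scope.
Local Open Scope ring_scope.

(** A constant sequence [u n = u] is enough: it suffices to find [u >= 1] with
    [P u] finite and [P u / u] tending to [0] at infinity, since then
    [u / P u] itself is the limit function.

    Write [u = expR v], and let [r y] be the mass that the chain at [y] puts on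
    [Ehat].  If [v z - v y <= N y] along the edges of [Ehat], and
    [v z - v y <= - M y] along all other edges, then
    [P u y / u y <= r y * expR (N y) + expR (- M y)] ([chain_op_le]).  So [v]
    may grow along the rare edges of [Ehat], as long as [expR (N y)] does not
    compensate [r y], and it has to decrease a lot along the others.

    Such a [v] exists as soon as these prescribed increments, seen as costs of
    edges, have nonnegative sum along every path issued from one fixed vertex
    [x0]: take for [v] the cheapest cost of reaching a vertex from [x0]
    ([path_potential]).  The frequency hypothesis provides the costs.  Apply it
    with the levels [a_j = b * expR (- 2 j)] to get sets [W_j], all with the
    same [lambda], and give an edge [e] the cost
    [\sum_j (1_(Ehat `&` W_j) e - lambda 1_(W_j) e)]: summed along a path from
    [x0], each layer [j] contributes a nonnegative amount
    ([layered_cost_path_ge0]).  Only the layers with [r y < a_j] contribute to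
    an edge issued from [y], and their number [N y] is about
    [ln (b / r y) / 2]; the factor 2 in [a_j] is what makes
    [r y * expR (N y)] small ([level_mass_le]).  An edge outside [Ehat] which
    lies in the first [k] sets [W_j] has cost at most [- lambda k]
    ([layered_cost_outside]).  As each [W_j] misses finitely many edges, all
    but finitely many vertices have all their edges in the first [k] sets, and
    there [P u / u <= C expR (- k) + expR (- lambda k)]. *)

(** * Paths of the chain *)

Lemma nb_stepsE (R : realType) (V : countType) (A : set (V * V)) (k : nat)
    (xs : nat -> V) :
  (nb_steps A k xs)%:R
  = \sum_(i < k) ((xs i, xs i.+1) \in A)%:R :> R.
Proof.
rewrite /nb_steps -sum1_card natr_sum big_mkcond /=.
by apply: eq_bigr => i _; rewrite inE; case: ifP.
Qed.

Lemma nstep_ge0 (R : realType) (V : countType) (p : V -> V -> R) :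
  (forall x y, 0 <= p x y) -> forall n x y, (0 <= nstep p n x y)%E.
Proof.
move=> p0; elim=> [|n IH] x y /=; first by rewrite lee_fin ler0n.
by apply: esum_ge0 => z _; rewrite mule_ge0 // lee_fin.
Qed.

Lemma nstep_gt0_path (R : realType) (V : countType) (p : V -> V -> R) :
  (forall x y, 0 <= p x y) -> forall n x y, (0 < nstep p n x y)%E ->
  exists xs, is_path (edges p) x n xs /\ xs n = y.
Proof.
move=> p0; elim=> [|n IH] x y /=.
  rewrite lte_fin ltr0n lt0b => /eqP ->.
  by exists (fun=> y); split => //; split.
move=> pos.
have [z zpos] : exists z, (0 < (p x z)%:E * nstep p n z y)%E.
  apply: contrapT => /forallNP none.
  move: pos; rewrite esum1 ?ltxx // => z _.
  apply/eqP; rewrite eq_le mule_ge0 ?lee_fin ?p0 ?nstep_ge0 // andbT.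
  by rewrite leNgt; apply/negP/none.
have pxz : 0 < p x z.
  rewrite lt_neqAle p0 andbT; apply/eqP => pz.
  by move: zpos; rewrite -pz mul0e ltxx.
have nz : (0 < nstep p n z y)%E.
  rewrite lt_neqAle nstep_ge0 // andbT; apply/eqP => pz.
  by move: zpos; rewrite -pz mule0 ltxx.
have [xs [[xs0 xsE] xsn]] := IH _ _ nz.
exists (fun i => if i is j.+1 then xs j else x); split => //; split => //.
by move=> [|i] ik /=; [rewrite xs0 | apply: xsE].
Qed.

(** * Potentials from path costs *)

(** The potential is the infimum of the costs of the paths from [x] to a given
    vertex.  The inequality along an edge holds because an edge can be appended
    to any path that reaches its source; nonnegativity of the path costs keeps
    the infimum from being degenerate. *)
Lemma path_potential (R : realType) (V : countType) (E : set (V * V))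
    (cost : V * V -> R) (x : V) :
  (forall y, exists k xs, is_path E x k xs /\ xs k = y) ->
  (forall k xs, is_path E x k xs ->
     0 <= \sum_(i < k) cost (xs i, xs i.+1)) ->
  exists v : V -> R, (forall y, 0 <= v y) /\
    forall y z, E (y, z) -> v z <= v y + cost (y, z).
Proof.
move=> reach nonneg.
pose S y := [set s : R | exists k xs, [/\ is_path E x k xs, xs k = y &
   s = \sum_(i < k) cost (xs i, xs i.+1)]].
have S0 y : S y !=set0.
  have [k [xs [pth xsk]]] := reach y.
  by exists (\sum_(i < k) cost (xs i, xs i.+1)), k, xs.
have Slb y : lbound (S y) 0 by move=> _ [k [xs [pth _ ->]]]; exact: nonneg.
exists (fun y => inf (S y)); split => [y|y z yz]; first exact: lb_le_inf.
rewrite -lerBlDr; apply: lb_le_inf => // _ [k [xs [[xs0 pth] xsk ->]]].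
rewrite lerBlDr; apply: ge_inf; first by exists 0.
(* [ys] is [xs] followed by the edge to [z]. *)
pose ys i := if (i <= k)%N then xs i else z.
have ysle i : (i <= k)%N -> ys i = xs i by rewrite /ys => ->.
have ysS : ys k.+1 = z by rewrite /ys ltnn.
exists k.+1, ys; split => //.
  split=> [|i]; first by rewrite ysle.
  rewrite ltnS leq_eqVlt => /orP[/eqP ->|ik]; first by rewrite ysS ysle // xsk.
  rewrite (ysle i) ?(ysle i.+1) //; last exact: ltnW.
  exact: pth.
rewrite big_ord_recr /= ysS ysle // xsk; congr (_ + _).
by apply: eq_bigr => i _; rewrite (ysle i) ?(ysle i.+1) // ltnW.
Qed.

(** * Layered costs *)

(** The sum over all layers [j] of [1_(A `&` W j) - lambda 1_(W j)], truncated
    at [N e.1] to be finite: in the use made of it below, no later [W j]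
    contains an edge issued from [e.1]. *)
Definition layered_cost (R : realType) (V : countType) (A : set (V * V))
    (W : nat -> set (V * V)) (N : V -> nat) (lambda : R) (e : V * V) : R :=
  \sum_(j < N e.1) ((e \in A `&` W j)%:R - lambda * (e \in W j)%:R).

Section LayeredCost.
Context (R : realType) (V : countType) (A : set (V * V))
  (W : nat -> set (V * V)) (N : V -> nat) (lambda : R).
Context (lambda0 : 0 < lambda)
  (WN : forall j y z, W j (y, z) -> (j < N y)%N).
Local Notation cost := (layered_cost A W N lambda).

(** With a truncation common to all vertices of the path, the sums over steps
    and layers can be exchanged, and each layer is nonnegative by the frequency
    hypothesis. *)
Lemma layered_cost_path_ge0 (k : nat) (xs : nat -> V) :
  (forall j, lambda * (nb_steps (W j) k xs)%:R <=
             (nb_steps (A `&` W j) k xs)%:R :> R) ->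
  0 <= \sum_(i < k) cost (xs i, xs i.+1).
Proof.
move=> freq.
pose J := (\max_(i < k) N (xs i))%N.
have costE (i : 'I_k) : cost (xs i, xs i.+1) =
    \sum_(j < J) (((xs i, xs i.+1) \in A `&` W j)%:R
                  - lambda * ((xs i, xs i.+1) \in W j)%:R).
  have NJ : (N (xs i) <= J)%N by rewrite /J (bigD1 i) //= leq_maxl.
  rewrite /layered_cost /= (big_ord_widen _ (fun j =>
    ((xs i, xs i.+1) \in A `&` W j)%:R
       - lambda * ((xs i, xs i.+1) \in W j)%:R) NJ).
  rewrite big_mkcond /=; apply: eq_bigr => j _; case: ifPn => // jN.
  have nW : ~ W j (xs i, xs i.+1) by move=> /WN; apply/negP.
  by rewrite !memNset ?mulr0 ?subr0 // => -[].
rewrite (eq_bigr _ (fun i _ => costE i)) exchange_big /=.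
apply: sumr_ge0 => j _; rewrite sumrB subr_ge0 -mulr_sumr -!nb_stepsE.
exact: freq.
Qed.

(** Each of the [N e.1] layers contributes at most 1. *)
Lemma layered_cost_le_depth (e : V * V) : cost e <= (N e.1)%:R.
Proof.
rewrite -[N e.1]card_ord -sum1_card natr_sum ler_sum // => j _.
have := ltW lambda0.
by case: (e \in _); case: (e \in _); rewrite /= ?mulr0 ?mulr1; lra.
Qed.

(** Outside [A] no layer contributes positively, and the first [k] ones
    contribute [- lambda] each. *)
Lemma layered_cost_outside (e : V * V) (k : nat) :
  ~ A e -> (k <= N e.1)%N -> (forall j, (j < k)%N -> W j e) ->
  cost e <= - (lambda * k%:R).
Proof.
move=> nA kN We.
pose d j : R := (j < k)%:R.
have -> : k%:R = \sum_(j < N e.1) d j.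
  rewrite /d -[k in k%:R]card_ord -sum1_card natr_sum.
  rewrite (big_ord_widen _ (fun=> 1%:R) kN) big_mkcond /=.
  by apply: eq_bigr => j _; case: ifP.
rewrite mulr_sumr -sumrN ler_sum // => j _.
rewrite memNset => [|[]//]; rewrite sub0r lerN2 ler_pM2l // /d.
case: (ltnP j k) => jk; last by rewrite ler0n.
by rewrite mem_set //; apply: We.
Qed.

End LayeredCost.

(** * Bounds on the chain operator *)

Lemma esum_scale_le (R : realType) (T : choiceType) (c : R) (a : T -> \bar R) :
  0 <= c -> (forall t, (0 <= a t)%E) ->
  (\esum_(t in [set: T]) (c%:E * a t) <= c%:E * \esum_(t in [set: T]) a t)%E.
Proof.
move=> c0 a0; apply: ge_ereal_sup => _ [X [finX XT] <-].
rewrite -ge0_mule_fsumr //; apply: lee_pmul => //; first exact: fsume_ge0.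
by apply: esum_ge; exists X.
Qed.

Section TransitionMatrix.
Context (R : realType) (V : countType) (p : V -> V -> R).
Context (p_trans : transition_matrix p).

Lemma esum_subset_le1 (S : set V) (y : V) :
  (\esum_(z in S) (p y z)%:E <= 1)%E.
Proof.
have [p0 p1] := p_trans.
rewrite -(p1 y) [leLHS]esum_mkcond; apply: le_esum => z _.
by case: ifP => //; rewrite lee_fin.
Qed.

Lemma mass_alongE (A : set (V * V)) (y : V) :
  (mass_along p A y)%:E = (\esum_(z in [set z | A (y, z)]) (p y z)%:E)%E.
Proof.
rewrite /mass_along fineK // ge0_fin_numE.
  by apply: le_lt_trans (esum_subset_le1 _ _) _; exact: ltry.
by apply: esum_ge0 => z _; rewrite lee_fin; case: p_trans.
Qed.

Lemma mass_along_le1 (A : set (V * V)) (y : V) : mass_along p A y <= 1.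
Proof. by rewrite -lee_fin mass_alongE; exact: esum_subset_le1. Qed.

Lemma mass_along_gt0 (A : set (V * V)) (y z : V) :
  A (y, z) -> 0 < p y z -> 0 < mass_along p A y.
Proof.
move=> Ayz pyz; apply: (lt_le_trans pyz); rewrite -lee_fin mass_alongE.
apply: esum_ge; exists [set z]; last by rewrite fsbig_set1.
by split=> [|_ -> //]; exact: finite_set1.
Qed.

Lemma chain_op_ge1 (u : V -> R) (y : V) :
  (forall z, 1 <= u z) -> (1 <= chain_op p u y)%E.
Proof.
have [p0 p1] := p_trans => u1.
by rewrite -(p1 y); apply: le_esum => z _; rewrite lee_fin ler_peMr.
Qed.

(** Split the row sum according to whether the edge lies in [A]; on the
    complement of [A] the transition probabilities have sum at most 1. *)
Lemma chain_op_le (A : set (V * V)) (u : V -> R) (y : V) (alpha beta : R) :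
  0 <= alpha -> 0 <= beta ->
  (forall z, 0 < p y z -> A (y, z) -> u z <= alpha) ->
  (forall z, 0 < p y z -> ~ A (y, z) -> u z <= beta) ->
  (chain_op p u y <= (mass_along p A y * alpha + beta)%:E)%E.
Proof.
have [p0 p1] := p_trans => alpha0 beta0 uA unA.
pose q z := if z \in [set z | A (y, z)] then (p y z)%:E else 0%E.
have q0 z : (0 <= q z)%E by rewrite /q; case: ifP => _; rewrite ?lee_fin.
have -> : (mass_along p A y * alpha + beta)%:E
    = (alpha%:E * (\esum_(z in [set: V]) q z)
       + beta%:E * \esum_(z in [set: V]) (p y z)%:E)%E.
  by rewrite p1 mule1 /q -esum_mkcond -mass_alongE mulrC.
have le2 : ((\esum_(z in [set: V]) (alpha%:E * q z))
            + \esum_(z in [set: V]) (beta%:E * (p y z)%:E)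
            <= alpha%:E * (\esum_(z in [set: V]) q z)
               + beta%:E * \esum_(z in [set: V]) (p y z)%:E)%E.
  by apply: leeD; apply: esum_scale_le => // z; rewrite lee_fin.
apply: le_trans le2.
rewrite -esumD; last 2 first.
- by move=> z _; rewrite mule_ge0.
- by move=> z _; rewrite -EFinM lee_fin mulr_ge0.
apply: le_esum => z _.
have [pz|pz] := eqVneq (p y z) 0.
  by rewrite pz mul0r mule0 adde0 mule_ge0.
have pgt0 : 0 < p y z by rewrite lt_neqAle eq_sym pz p0.
rewrite /q; case: ifPn => [/set_mem Ayz|/negP nAyz].
  by rewrite -!EFinM -EFinD lee_fin mulrC ler_wpDr ?mulr_ge0 // ler_wpM2r ?uA.
rewrite mule0 add0e -EFinM lee_fin mulrC ler_wpM2r ?unA // => Ayz.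
by apply: nAyz; rewrite inE.
Qed.

End TransitionMatrix.

(** * Numerical estimates *)

Lemma geometric_level (R : realType) (b r : R) : 0 <= b -> 0 < r ->
  exists N : nat, b * expR (- (2 * N%:R)) <= r /\
    forall j, (j < N)%N -> r < b * expR (- (2 * j%:R)).
Proof.
move=> b0 r0.
have ex : exists N : nat, b * expR (- (2 * N%:R)) <= r.
  exists (Num.Def.archi_bound (b / r)).
  have /archi_boundP : 0 <= b / r by rewrite divr_ge0 // ltW.
  set n := Num.Def.archi_bound _; rewrite ltr_pdivrMr // => bn.
  rewrite expRN ler_pdivrMr ?expR_gt0 //.
  apply: (le_trans (ltW bn)); rewrite mulrC ler_pM2l //.
  have := expR_ge1Dx (2 * n%:R : R); have := ler0n R n; lra.
case: (ex_minnP ex) => N leN minN; exists N; split => // j jN.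
by rewrite ltNge; apply/negP => /minN; rewrite leqNgt jN.
Qed.

(** If [N = m.+1], then [r < b expR (- 2 m)], so that [r expR N] is at most
    [b expR 2 * expR (- N)].  If [N = 0] then [k = 0], and the term 1 in the
    constant covers [r <= 1]. *)
Lemma level_mass_le (R : realType) (b r : R) (k N : nat) :
  0 <= b -> r <= 1 -> (k <= N)%N ->
  (forall j, (j < N)%N -> r < b * expR (- (2 * j%:R))) ->
  r * expR N%:R <= (b * expR 2 + 1) * expR (- k%:R).
Proof.
move=> b0 r1; case: N => [|m] kN lev.
  move: kN; rewrite leqn0 => /eqP ->.
  rewrite oppr0 expR0 !mulr1; have := mulr_ge0 b0 (expR_ge0 2); lra.
apply: (@le_trans _ _ (b * expR 2 * expR (- k%:R))); last first.
  by rewrite ler_pM2r ?expR_gt0 // lerDl.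
apply: (@le_trans _ _ (b * expR (- (2 * m%:R)) * expR m.+1%:R)).
  by rewrite ler_pM2r ?expR_gt0 // ltW // lev.
rewrite -!mulrA -!expRD ler_wpM2l // ler_expR.
have : k%:R <= m.+1%:R :> R by rewrite ler_nat.
rewrite -natr1; lra.
Qed.

Lemma exp_decay_small (R : realType) (C lambda eps : R) :
  0 <= C -> 0 < lambda -> 0 < eps ->
  exists k : nat, C * expR (- k%:R) + expR (- (lambda * k%:R)) < eps.
Proof.
move=> C0 l0 e0.
(* Both exponentials are at most [expR (- mu k)], and [expR (mu k) >= mu k]. *)
pose mu := Num.min 1 lambda.
have mu0 : 0 < mu by rewrite lt_min ltr01.
have mu1 : mu <= 1 by rewrite ge_min lexx.
have mul : mu <= lambda by rewrite ge_min lexx orbT.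
have q0 : 0 <= (C + 1) / (eps * mu).
  by rewrite divr_ge0 ?addr_ge0 // ltW // mulr_gt0.
exists (Num.Def.archi_bound ((C + 1) / (eps * mu))).
have := archi_boundP q0; set k := Num.Def.archi_bound _.
rewrite ltr_pdivrMr ?mulr_gt0 // => kb.
have k0 := ler0n R k.
apply: (@le_lt_trans _ _ ((C + 1) * expR (- (mu * k%:R)))).
  rewrite mulrDl mul1r lerD // ?ler_wpM2l // ler_expR lerN2 ?ler_wpM2r //.
  by rewrite ler_piMl.
rewrite expRN ltr_pdivrMr ?expR_gt0 //; apply: (lt_le_trans kb).
rewrite mulrCA ler_pM2l // mulrC.
have := expR_ge1Dx (mu * k%:R); lra.
Qed.

(** * The chain compactness condition *)

Theorem propositionA1 (R : realType) (V : countType) (p : V -> V -> R)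
    (p_trans : transition_matrix p) (p_irr : irreducible_chain p)
    (Ehat : set (V * V)) (Ehat_sub : Ehat `<=` edges p)
    (Ehat_out : forall y : V, exists z : V, Ehat (y, z))
    (mass_vanish : vanishes_at_infinity (mass_along p Ehat))
    (Ehat_freq : forall x : V, exists a0 lambda : R,
      0 < a0 /\ 0 < lambda /\
      forall a : R, 0 < a -> a < a0 ->
        exists W : set (V * V),
          W `<=` edges p /\
          finite_set (edges p `\` W) /\
          (forall y z : V, W (y, z) -> mass_along p Ehat y < a) /\
          (forall (k : nat) (xs : nat -> V), is_path (edges p) x k xs ->
            lambda * (nb_steps W k xs)%:R <=
              (nb_steps (Ehat `&` W) k xs)%:R)) :
  chain_compactness p.
Proof.
have [p0 p1] := p_trans.
have [[x0 _]|noV] := pselect (exists x : V, True); last first.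
  have absurdV (x : V) : False by apply: noV; exists x.
  exists (fun _ _ => 1); split=> [? //|]; split=> [x|]; first by case: absurdV.
  split; first by exists 1.
  split=> [x|]; first by case: absurdV.
  exists (fun=> 1); split=> // ; split=> [x|l]; first by case: absurdV.
  apply: sub_finite_set (finite_set0 V) => x; by case: absurdV.
(* From now on [x0] is the origin of all paths. *)
have [a0 [lambda [a00 [lambda0 freq]]]] := Ehat_freq x0.
pose r := mass_along p Ehat.
pose b := a0 / 2.
have b0 : 0 < b by rewrite divr_gt0.
pose a (j : nat) := b * expR (- (2 * j%:R)).
have exW j : exists Wj : set (V * V),
    Wj `<=` edges p /\ finite_set (edges p `\` Wj) /\
    (forall y z, Wj (y, z) -> r y < a j) /\
    (forall k xs, is_path (edges p) x0 k xs ->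
      lambda * (nb_steps Wj k xs)%:R <= (nb_steps (Ehat `&` Wj) k xs)%:R).
  apply: freq; first by rewrite mulr_gt0 ?expR_gt0.
  apply: (@le_lt_trans _ _ b); last by rewrite /b; lra.
  by rewrite ler_piMr ?(ltW b0) // -expR0 ler_expR oppr_le0.
have [W HW] := choice exW.
have exN y : exists N : nat,
    a N <= r y /\ forall j, (j < N)%N -> r y < a j.
  apply: geometric_level; first exact: ltW.
  have [z yz] := Ehat_out y.
  exact: (mass_along_gt0 p_trans yz (Ehat_sub _ yz)).
have [N HN] := choice exN.
have WN j y z : W j (y, z) -> (j < N y)%N.
  move=> Wyz; rewrite ltnNge; apply/negP => Nj.
  have [_ [_ [/(_ _ _ Wyz) ra _]]] := HW j.
  have [aN _] := HN y.
  have : a j <= a (N y).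
    by rewrite ler_pM2l // ler_expR lerN2 ler_pM2l // ler_nat.
  by move=> /le_trans /(_ aN); rewrite leNgt ra.
pose cost := layered_cost Ehat W N lambda.
have [v [v0 vE]] : exists v : V -> R, (forall y, 0 <= v y) /\
    forall y z, edges p (y, z) -> v z <= v y + cost (y, z).
  apply: (@path_potential R V (edges p) cost x0) => [y|k xs pth].
    by have [n /(nstep_gt0_path p0)] := p_irr x0 y; exists n.
  apply: (layered_cost_path_ge0 WN) => j.
  by have [_ [_ [_]]] := HW j; apply.
pose u y := expR (v y).
have u1 y : 1 <= u y by rewrite -expR0 ler_expR.
have u0 y : 0 < u y by exact: expR_gt0.
pose C := b * expR 2 + 1.
have C0 : 0 <= C by rewrite addr_ge0 // mulr_ge0 ?expR_ge0 ?ltW.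
pose eps (k : nat) := C * expR (- k%:R) + expR (- (lambda * k%:R)).
(* For [k = 0] the condition is void, and this gives finiteness of [P u]. *)
have Pu_le k y : (forall z j, edges p (y, z) -> (j < k)%N -> W j (y, z)) ->
    (chain_op p u y <= (u y * eps k)%:E)%E.
  move=> Wy.
  have kN : (k <= N y)%N.
    case: k Wy => // k Wy; have [z /Ehat_sub yz] := Ehat_out y.
    exact: WN (Wy z k yz (ltnSn k)).
  have le1 := @chain_op_le R V p p_trans Ehat u y (u y * expR (N y)%:R)
    (u y * expR (- (lambda * k%:R))).
  apply: (le_trans (le1 _ _ _ _)).
  - by rewrite mulr_ge0 ?expR_ge0.
  - by rewrite mulr_ge0 ?expR_ge0.
  - move=> z pz Az; rewrite -expRD ler_expR (le_trans (vE _ _ pz)) // lerD2l.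
    exact: (layered_cost_le_depth Ehat W N lambda0 (y, z)).
  - move=> z pz nAz; rewrite -expRD ler_expR (le_trans (vE _ _ pz)) // lerD2l.
    by apply: layered_cost_outside => // j jk; exact: Wy.
  rewrite lee_fin mulrCA -mulrDr ler_pM2l // lerD2r.
  have [_ lev] := HN y.
  by apply: level_mass_le => //; [exact: ltW | exact: mass_along_le1].
have Pu_fin y : chain_op p u y \is a fin_num.
  rewrite ge0_fin_numE; last exact: le_trans (chain_op_ge1 _ _ _).
  by apply: le_lt_trans (Pu_le 0%N y _) _ => //; exact: ltry.
pose Pu y := fine (chain_op p u y).
have PuE y : (Pu y)%:E = chain_op p u y by rewrite fineK.
have Pu0 y : 0 < Pu y.
  by apply: (lt_le_trans ltr01); rewrite -lee_fin PuE chain_op_ge1.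
exists (fun=> u); split=> //; split=> [y _|]; first by rewrite -PuE ltry.
split; first by exists 1; split.
split=> [y|]; first by exists (u y).
exists (fun y => u y / Pu y); split=> [y|]; first by rewrite divr_gt0.
split=> [y|l]; first exact: cvg_cst.
have [k epsk] := exp_decay_small C0 lambda0 (expR_gt0 (- l)).
(* The sources of the edges missed by one of the first [k] sets [W j]. *)
pose F := \bigcup_(j in `I_k) (fst @` (edges p `\` W j)).
apply: (@sub_finite_set _ _ F); last first.
  apply: bigcup_finite => // j _; apply: finite_image.
  by have [_ [? _]] := HW j.
move=> y /= lny; apply: contrapT => nF.
have : (chain_op p u y <= (u y * eps k)%:E)%E.
  apply: Pu_le => z j yz jk; apply: contrapT => nW.
  by apply: nF; exists j => //; exists (y, z).
rewrite -PuE lee_fin => Pule.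
move: lny; rewrite -{1}(expRK l) ler_ln ?posrE ?divr_gt0 ?expR_gt0 //.
apply/negP; rewrite -ltNge ltr_pdivlMr // mulrC.
apply: (@le_lt_trans _ _ (u y * eps k * expR l)).
  by rewrite ler_pM2r ?expR_gt0.
rewrite -mulrA -[ltRHS]mulr1 ltr_pM2l //.
by rewrite -(mulVf (lt0r_neq0 (expR_gt0 l))) -expRN ltr_pM2r ?expR_gt0.
Qed.
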